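(* Let $1\le d\le 5$ and let $\omega$ be a weight function on $F_d$ such that the weighted graph $(F_d,\omega)$ has minimum degree at least $5/14$, i.e. $\omega(N(v))\ge 5/14$ for every vertex $v$. Then $(F_d,\omega)$ has a sparse half.
   Context: For an integer $d\ge1$, $F_d$ is the graph with vertex set $\{v_1,\dots,v_{3d-1}\}$ in which $v_j$ is adjacent to $v_{j+d},\dots,v_{j+2d-1}$, indices modulo $3d-1$. A weight function on a graph $G$ is a map $\omega:V(G)\to(0,1)$ with $\sum_v\omega(v)=1$; $\omega(X)=\sum_{x\in X}\omega(x)$, and $N(v)$ is the neighbourhood of $v$. A half of $(G,\omega)$ is a function $s:V(G)\to\mathbb{R}_{\ge0}$ with $s(v)\le\omega(v)$ for all $v$ and $\sum_v s(v)=1/2$; it is a sparse half if $\sum_{uv\in E(G)}s(u)s(v)\le 1/50$. *)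

(* Defs.v *)
From mathcomp Require Import all_boot all_order all_algebra reals.
From mathcomp Require Import zify.

Set Implicit Arguments.
Unset Strict Implicit.
Unset Printing Implicit Defensive.

Import Order.TTheory GRing.Theory Num.Theory.
Local Open Scope ring_scope.

(* The vertex v_j of F_d is the residue of j modulo 3d - 1; the neighbours of
   v_j are v_(j+d+k) for 0 <= k < d. *)
Definition F_adj (d : nat) : rel 'I_(3 * d - 1) :=
  fun i j => [exists k : 'I_d, (j : nat) == ((i + d + k) %% (3 * d - 1))%N].

Lemma F_adj_sym (d : nat) : symmetric (@F_adj d).
Proof.
suff H (i j : 'I_(3 * d - 1)) : F_adj i j -> F_adj j i.
  by move=> i j; apply/idP/idP; apply: H.
case/existsP=> k /eqP jE; apply/existsP.
have kd := ltn_ord k; have il := ltn_ord i.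
have k'd : (d - 1 - k < d)%N by lia.
exists (Ordinal k'd); apply/eqP => /=.
rewrite jE -addnA modnDml.
have -> : (i + d + k + (d + (d - 1 - k)) = i + (3 * d - 1))%N by lia.
by rewrite modnDr modn_small.
Qed.

Lemma F_adj_irr (d : nat) : irreflexive (@F_adj d).
Proof.
move=> i; apply/negbTE/existsP => -[k /eqP iE].
have kd := ltn_ord k; have il := ltn_ord i.
have lt : (d + k < 3 * d - 1)%N by lia.
have : (i + 0 == i + (d + k) %[mod 3 * d - 1])%N.
  by rewrite addn0 addnA -iE modn_small.
by rewrite eqn_modDl mod0n modn_small //; lia.
Qed.

Section WeightedGraphs.
Variables (R : realType) (V : finType) (E : rel V).
Implicit Types (w s : V -> R).

Definition nbhd (v : V) : {set V} := [set u | E v u].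

Definition edges : {set {set V}} := [set [set p.1; p.2] | p in [pred p : V * V | E p.1 p.2]].

Definition weight w (X : {set V}) : R := \sum_(x in X) w x.

Definition is_weight w : Prop :=
  (forall v, 0 < w v < 1) /\ \sum_v w v = 1.

Definition min_degree_ge w (c : R) : Prop :=
  forall v, c <= weight w (nbhd v).

Definition is_half w s : Prop :=
  (forall v, 0 <= s v <= w v) /\ \sum_v s v = 1 / 2.

(* For E irreflexive every edge is a two-element set {u, v}, so the product
   over the edge is s(u) s(v), and each edge is counted once. *)
Definition is_sparse_half w s : Prop :=
  is_half w s /\ \sum_(e in edges) \prod_(x in e) s x <= 1 / 50.

End WeightedGraphs.

(* Main.v *)
Require Import Defs.
From mathcomp Require Import all_boot all_order all_algebra reals.
From mathcomp Require Import zify ring lra.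

(** The neighbourhoods of F_d are exactly its arcs of d consecutive vertices, so
    in units of 1/14 every d-arc weighs at least 5. Removing two disjoint d-arcs
    leaves a (d-1)-arc of weight at most 4, hence every vertex weighs at least 1.
    A half can be taken inside a d-arc of weight at least 7, which spans no edge;
    otherwise halves are sought on d+1 or d+2 consecutive vertices, which span
    one, respectively three, edges.

    A (d+1)-arc of weight at least 7 contains two extremal halves, obtained by
    filling it from either end. If neither is sparse the arc is called tight, and
    both its end vertices weigh almost 2.

    - d = 1: one of the two vertices weighs at least 7.
    - d = 2: the five halves filling 3-arcs from the left are sparse on average.
    - d = 3: one of any two complementary 4-arcs is heavy. If all heavy ones are
      tight, the pattern of their positions on the cycle is determined up to
      rotation, and the total weight is too small.
    - d = 4: if some 5-arc is tight, one of its ends and a vertex of weight at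
      most 3/2 are the ends of another 5-arc, which almost contains a sparse
      half. If no 5-arc weighs 7, the eleven halves filling 6-arcs from the left
      are sparse on average.
    - d = 5: all weights equal 1 and any seven consecutive vertices work. *)

Set Implicit Arguments.
Unset Strict Implicit.
Unset Printing Implicit Defensive.

Import Order.TTheory GRing.Theory Num.Theory.
Local Open Scope ring_scope.

Lemma exists_le_mean (R : realDomainType) (I : finType) (f : I -> R) (c : R) :
  (0 < #|I|)%N -> \sum_i f i <= c *+ #|I| -> exists i, f i <= c.
Proof.
move=> I0 fc; apply/existsP; apply: contraLR fc => /existsPn fc.
rewrite -ltNge -sumr_const; apply: ltr_sum => [|i _]; last by rewrite ltNge fc.
by apply/hasP; have /card_gt0P[i _] := I0; exists i; rewrite ?mem_index_enum.
Qed.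

Lemma sum_nat_truncate (V : nmodType) (F : nat -> V) (l m n : nat) :
  (m <= n)%N -> (forall k, (m <= k)%N -> F k = 0) ->
  \sum_(l <= k < n) F k = \sum_(l <= k < m) F k.
Proof.
move=> mn F0; have [lm|/ltnW ml] := leqP l m; last first.
  rewrite [RHS]big_geq // big_nat big1 // => k /andP[lk _].
  exact/F0/leq_trans/lk.
rewrite (big_cat_nat lm mn) /= [X in _ + X]big_nat [X in _ + X]big1 ?addr0 //.
by move=> k /andP[/F0].
Qed.

Lemma sum_edges_oriented (R : comPzRingType) (V : finType) (E : rel V)
    (f : V -> nat) (s : V -> R) :
  irreflexive E -> symmetric E -> injective f ->
  \sum_(e in edges E) \prod_(x in e) s x =
  \sum_u \sum_(v | E u v && (f u < f v)%N) s u * s v.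
Proof.
move=> Eirr Esym finj; pose ends (p : V * V) := [set p.1; p.2].
pose A := [set p : V * V | E p.1 p.2 && (f p.1 < f p.2)%N].
have -> : edges E = ends @: A.
  apply/setP => e; apply/imsetP/imsetP => -[[u v]].
    rewrite inE /= => Euv ->; have [uv|vu|/finj uv] := ltngtP (f u) (f v).
    - by exists (u, v); rewrite // inE Euv.
    - by exists (v, u); rewrite ?inE 1?Esym ?Euv //= /ends /= setUC.
    - by rewrite uv Eirr in Euv.
  by rewrite !inE => /andP[Euv _] ->; exists (u, v).
rewrite big_imset /=.
  rewrite pair_big_dep /=; apply: eq_big => [p|[u v]]; first by rewrite inE.
  rewrite inE => /andP[_ /= uv].
  by rewrite big_setU1 ?big_set1 // inE; apply: contraTneq uv => /= ->; rewrite ltnn.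
move=> [u v] [u' v']; rewrite !inE /= => /andP[_ uv] /andP[_ uv'] /setP eqe.
move: (eqe u) (eqe v) uv; rewrite !inE /= !eqxx orbT.
move=> /esym/pred2P[] -> /esym/pred2P[] -> //; first by rewrite ltnn.
- by move/(ltn_trans uv'); rewrite ltnn.
- by rewrite ltnn.
Qed.

Definition residue (n : nat) (npos : (0 < n)%N) (j : nat) : 'I_n :=
  Ordinal (ltn_pmod j npos).

Section Rotation.
Variables (n : nat) (npos : (0 < n)%N).

Lemma residue_addn (j : nat) : residue npos (j + n) = residue npos j.
Proof. by apply/val_inj; rewrite /= modnDr. Qed.

Lemma residue_addl_inj (i : nat) : injective (fun k : 'I_n => residue npos (i + k)).
Proof.
by move=> a b [/eqP]; rewrite eqn_modDl !modn_small // => /eqP/val_inj.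
Qed.

Lemma sum_residue (V : nmodType) (i : nat) (f : 'I_n -> V) :
  \sum_(k < n) f (residue npos (i + k)) = \sum_v f v.
Proof. by rewrite [RHS](reindex_inj (@residue_addl_inj i)). Qed.

End Rotation.

Definition arc_weight (R : nmodType) (z : nat -> R) (i m : nat) : R :=
  \sum_(k < m) z (i + k)%N.

Lemma arc_weightD (R : nmodType) (z : nat -> R) (i m n : nat) :
  arc_weight z i (m + n) = arc_weight z i m + arc_weight z (i + m) n.
Proof.
rewrite /arc_weight big_split_ord /=; congr (_ + _).
by apply: eq_bigr => k _; rewrite addnA.
Qed.

Lemma arc_weight0 (R : nmodType) (z : nat -> R) (i : nat) : arc_weight z i 0 = 0.
Proof. exact: big_ord0. Qed.

Lemma arc_weightS (R : nmodType) (z : nat -> R) (i m : nat) :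
  arc_weight z i m.+1 = z i + arc_weight z i.+1 m.
Proof. by rewrite -add1n arc_weightD /arc_weight big_ord1 addn0 addn1. Qed.

Lemma arc_weightSr (R : nmodType) (z : nat -> R) (i m : nat) :
  arc_weight z i m.+1 = arc_weight z i m + z (i + m)%N.
Proof. by rewrite /arc_weight big_ord_recr. Qed.

(* Two of at most 2d consecutive vertices are adjacent in F_d if and only if their
   positions differ by at least d. *)
Definition arc_edge_sum (R : pzSemiRingType) (d : nat) (c : seq R) : R :=
  \sum_(0 <= a < size c) \sum_(a + d <= b < size c) c`_a * c`_b.

Lemma arc_edge_sumZ (R : comPzRingType) (d : nat) (k : R) (c : seq R) :
  arc_edge_sum d [seq k * x | x <- c] = k ^+ 2 * arc_edge_sum d c.
Proof.
rewrite /arc_edge_sum size_map mulr_sumr !big_mkord; apply: eq_bigr => a _.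
rewrite mulr_sumr 2!big_nat; apply: eq_bigr => b /andP[_ bc].
by rewrite !(nth_map 0) // mulrACA.
Qed.

Lemma arc_edge_sum_sizeSS (R : pzSemiRingType) (d : nat) (c : seq R) : size c = d.+2 ->
  arc_edge_sum d c = c`_0 * c`_d + c`_0 * c`_d.+1 + c`_1 * c`_d.+1.
Proof.
rewrite /arc_edge_sum => ->; rewrite big_ltn // big_ltn //.
rewrite [X in _ + (_ + X)]big_nat [X in _ + (_ + X)]big1 => [|a /andP[a2 _]]; last first.
  by rewrite big_geq //; lia.
by rewrite add0n add1n big_ltn // !big_nat1 addr0.
Qed.

Section Adjacency.
Variables (d : nat) (npos : (0 < 3 * d - 1)%N).
Local Notation v_ := (residue npos).

Lemma F_adj_residue (i a b : nat) : (a < b < 3 * d - 1)%N ->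
  F_adj (v_ (i + a)) (v_ (i + b)) = (a + d <= b < a + d.*2)%N.
Proof.
move=> /andP[ab bn].
have mod_eq k : (v_ (i + b) == (v_ (i + a) + d + k) %% (3 * d - 1) :> nat)%N
    = (b - a == d + k %[mod 3 * d - 1])%N.
  by rewrite /= -addnA modnDml -addnA eqn_modDl -[in LHS](subnKC (ltnW ab)) eqn_modDl.
apply/existsP/idP => [[k]|dab].
  by rewrite mod_eq; have kd := ltn_ord k; rewrite !modn_small; lia.
have kd : (b - (a + d) < d)%N by lia.
by exists (Ordinal kd); rewrite mod_eq; apply/eqP; congr (_ %% _)%N => /=; lia.
Qed.

Lemma weight_nbhd_residue (R : realType) (w : 'I_(3 * d - 1) -> R) (i : nat) :
  weight w (nbhd (@F_adj d) (v_ (i + (2 * d - 1)))) = arc_weight (w \o v_) i d.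
Proof.
have dn : (d <= 3 * d - 1)%N by lia.
have nbr (k : 'I_d) : v_ (v_ (i + (2 * d - 1)) + d + k) = v_ (i + k).
  rewrite -(residue_addn npos (i + k)); apply/val_inj => /=.
  by rewrite -addnA modnDml; congr (_ %% _)%N; lia.
rewrite /weight (_ : nbhd _ _ = [set v_ (i + k) | k : 'I_d]).
  rewrite big_imset //= => a b _ _ eq_v; apply/val_inj.
  exact: (congr1 val (@residue_addl_inj _ npos i (widen_ord dn a) (widen_ord dn b) eq_v)).
apply/setP => u; rewrite inE; apply/existsP/imsetP => [[k /eqP uE]|[k _ ->]].
  by exists k => //; rewrite -nbr; apply/val_inj.
by exists k; rewrite -nbr.
Qed.

Lemma sum_edges_arc (R : comPzRingType) (i : nat) (c : seq R) (s : 'I_(3 * d - 1) -> R) :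
  (size c <= d.*2)%N -> (forall k : 'I_(3 * d - 1), s (v_ (i + k)) = c`_k) ->
  \sum_(e in edges (@F_adj d)) \prod_(x in e) s x = arc_edge_sum d c.
Proof.
move=> size_c sE; pose shift_inj := @residue_addl_inj _ npos i.
have size_n : (size c <= 3 * d - 1)%N by lia.
have c0 k : (size c <= k)%N -> c`_k = 0 by apply: nth_default.
rewrite (@sum_edges_oriented _ _ _ (invF shift_inj)); first last.
- exact: inj_comp val_inj (can_inj (f_invF shift_inj)).
- exact: F_adj_sym.
- exact: F_adj_irr.
rewrite (reindex_inj shift_inj) /arc_edge_sum.
rewrite -(@sum_nat_truncate _ _ 0 _ _ size_n) ?big_mkord; last first.
  by move=> a ca; rewrite big1 // => b _; rewrite c0 ?mul0r.
apply: eq_bigr => a _; rewrite (reindex_inj shift_inj).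
rewrite -(@sum_nat_truncate _ _ _ _ _ size_n); last first.
  by move=> b cb; rewrite (c0 b) ?mulr0.
rewrite big_geq_mkord [LHS]big_mkcond [RHS]big_mkcond; apply: eq_bigr => b _ /=.
rewrite !invF_f !sE; have [ab|ba] := ltnP a b; last first.
  by rewrite andbF; case: ifP => //; lia.
rewrite andbT F_adj_residue ?ab ?(ltn_ord b) //.
have [bs|bs] := ltnP b (size c); last by rewrite (c0 b) // mulr0 !if_same.
by congr (if _ then _ else _); lia.
Qed.

End Adjacency.

(* Weights of the cyclic sequence of vertices of F_d in units of 1/14; the
   neighbourhoods of F_d are the arcs of d consecutive vertices. *)
Definition cyclic_weight (R : numDomainType) (d : nat) (z : nat -> R) : Prop :=
  (forall i, arc_weight z i (3 * d - 1) = 14) /\ (forall i, 5 <= arc_weight z i d).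

(* A sparse half in the same units, so that 1/50 becomes 196/50 = 98/25; the
   list c gives its values on consecutive vertices from the i-th on. *)
Definition has_sparse_arc (R : numFieldType) (d : nat) (z : nat -> R) : Prop :=
  exists i (c : seq R), [/\ (size c <= d.*2)%N, forall k, 0 <= c`_k <= z (i + k)%N,
    \sum_(x <- c) x = 7 & arc_edge_sum d c <= 98 / 25].

Section FromCyclicWeights.
Variables (R : realType) (d : nat) (npos : (0 < 3 * d - 1)%N) (w : 'I_(3 * d - 1) -> R).
Let z (j : nat) : R := 14 * w (residue npos j).

Lemma cyclic_weight_residue :
  is_weight w -> min_degree_ge (@F_adj d) w (5 / 14) -> cyclic_weight d z.
Proof.
move=> [_ sum_w] deg; split=> i; rewrite /arc_weight -mulr_sumr.
- by rewrite sum_residue sum_w mulr1.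
- have := deg (residue npos (i + (2 * d - 1))).
  by rewrite weight_nbhd_residue /arc_weight /=; lra.
Qed.

Lemma sparse_half_of_arc :
  has_sparse_arc d z -> exists s, is_sparse_half (@F_adj d) w s.
Proof.
move=> [i [c [size_c cz c7 c_sparse]]]; pose shift_inj := @residue_addl_inj _ npos i.
pose s v := c`_(invF shift_inj v) / 14.
have sE (k : 'I_(3 * d - 1)) : s (residue npos (i + k)) = c`_k / 14.
  by rewrite /s invF_f.
exists s; split; first split.
- move=> v; have := cz (invF shift_inj v); rewrite /z (f_invF shift_inj v) /s; lra.
- rewrite -(sum_residue npos i); under eq_bigr => k _ do rewrite sE.
  rewrite -mulr_suml -(big_mkord xpredT (fun k => c`_k)) (@sum_nat_truncate _ _ 0 (size c)).
  + by rewrite -(big_nth 0 xpredT id) c7; lra.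
  + lia.
  + by move=> k; apply: nth_default.
rewrite (@sum_edges_arc _ _ _ i [seq 14^-1 * x | x <- c]) ?size_map //; last first.
  move=> k; rewrite sE mulrC; have [kc|kc] := ltnP k (size c); first by rewrite (nth_map 0).
  by rewrite !nth_default ?size_map ?mulr0.
by rewrite arc_edge_sumZ; lra.
Qed.

End FromCyclicWeights.

Section CyclicWeights.
Variables (R : realFieldType) (d : nat) (z : nat -> R).
Hypothesis zP : cyclic_weight d z.

Lemma cyclic_weight_d_gt0 : (0 < d)%N.
Proof. by case: d zP => // -[_ /(_ 0%N)]; rewrite arc_weight0; lra. Qed.

Lemma arc_weight_head (i : nat) : arc_weight z i d = z i + arc_weight z i.+1 d.-1.
Proof. by rewrite -arc_weightS prednK // cyclic_weight_d_gt0. Qed.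

Lemma arc_weight_last (i : nat) :
  arc_weight z i.+1 d = arc_weight z i.+1 d.-1 + z (i + d)%N.
Proof.
have d_gt0 := cyclic_weight_d_gt0.
by rewrite -{1}(prednK d_gt0) arc_weightSr addSnnS prednK.
Qed.

Lemma cyclic_weight_periodic (i : nat) : z (i + (3 * d - 1))%N = z i.
Proof.
have [total _] := zP; have := total i; have := total i.+1.
have := arc_weightS z i (3 * d - 1); rewrite arc_weightSr; lra.
Qed.

Lemma arc_weight_complement (i m : nat) : (m <= 3 * d - 1)%N ->
  arc_weight z (i + m) (3 * d - 1 - m) = 14 - arc_weight z i m.
Proof.
by move=> mn; have [/(_ i) <- _] := zP; rewrite -[in RHS](subnKC mn) arc_weightD; lra.
Qed.

Lemma arc_weight_pred_le4 (i : nat) : arc_weight z i d.-1 <= 4.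
Proof.
have [total deg] := zP; have d_gt0 := cyclic_weight_d_gt0.
have := total i; have -> : (3 * d - 1 = d.-1 + (d + d))%N by lia.
rewrite !arc_weightD; have := deg (i + d.-1)%N; have := deg (i + d.-1 + d)%N; lra.
Qed.

Lemma cyclic_weight_ge1 (i : nat) : 1 <= z i.
Proof.
have [_ deg] := zP; have := deg i; have := arc_weight_pred_le4 i.+1.
by rewrite arc_weight_head; lra.
Qed.

Lemma cyclic_weight_ge0 (i : nat) : 0 <= z i.
Proof. exact: le_trans ler01 (cyclic_weight_ge1 i). Qed.

Lemma arc_weight_ge0 (i m : nat) : 0 <= arc_weight z i m.
Proof. by apply: sumr_ge0 => k _; apply: cyclic_weight_ge0. Qed.

(* An arc of d vertices spans no edge. *)
Lemma sparse_arc_of_heavy_nbhd (i : nat) : 7 <= arc_weight z i d -> has_sparse_arc d z.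
Proof.
set S := arc_weight z i d => S7.
have [ratio_ge0 ratio_le1] : 0 <= 7 / S /\ 7 / S <= 1.
  by rewrite divr_ge0 ?ler_pdivrMr ?mul1r; lra.
exists i, (mkseq (fun k => 7 / S * z (i + k)%N) d).
rewrite /arc_edge_sum size_mkseq; split.
- by rewrite -addnn leq_addr.
- move=> k; have z_ge0 := cyclic_weight_ge0 (i + k).
  have [kd|kd] := ltnP k d; last by rewrite nth_default ?size_mkseq // lexx.
  by rewrite nth_mkseq // mulr_ge0 //= ler_piMl.
- rewrite big_map -{1}(subn0 d) big_mkord -mulr_sumr -/(arc_weight z i d) -/S; field; lra.
rewrite big1_seq; first lra.
move=> a _; rewrite big_geq //; lia.
Qed.

(* The values a, b, e are put on the positions 0, d and d + 1 of an arc of d + 2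
   vertices, whose only edges join 0 to d, 0 to d + 1 and 1 to d + 1. *)
Lemma sparse_arc_of_ends (i : nat) (a b e : R) : (1 < d)%N ->
  0 <= a <= z i -> 0 <= b <= z (i + d)%N -> 0 <= e <= z (i + d.+1)%N ->
  a + arc_weight z i.+1 d.-1 + b + e = 7 ->
  a * b + (a + z i.+1) * e <= 98 / 25 -> has_sparse_arc d z.
Proof.
move=> d_gt1 az bz ez weight7 cost.
pose inner := mkseq (fun k => z (i.+1 + k)%N) d.-1.
pose c := a :: inner ++ [:: b; e].
have size_inner : size inner = d.-1 by rewrite size_mkseq.
have size_c : size c = d.+2 by rewrite /= size_cat size_inner /=; lia.
have c1 : c`_1 = z i.+1.
  by rewrite /= nth_cat size_inner ifT ?nth_mkseq ?addn0 //; lia.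
have cd : c`_d = b.
  by rewrite -(prednK (ltnW d_gt1)) /= nth_cat size_inner ltnn subnn.
have cd1 : c`_d.+1 = e.
  by rewrite /= nth_cat size_inner ltnNge leq_pred /= -{1}(prednK (ltnW d_gt1)) subSnn.
exists i, c; rewrite size_c; split.
- lia.
- move=> k; have [|kd] := ltnP k d.+2; last first.
    by rewrite nth_default ?size_c // lexx cyclic_weight_ge0.
  rewrite ltnS leq_eqVlt => /predU1P[->|]; first by rewrite cd1.
  rewrite ltnS leq_eqVlt => /predU1P[->|]; first by rewrite cd.
  case: k => [|k] kd; first by rewrite addn0.
  have {}kd : (k < d.-1)%N by lia.
  by rewrite /= nth_cat size_inner kd nth_mkseq // addSnnS lexx cyclic_weight_ge0.
- rewrite big_cons big_cat /= big_map -{1}(subn0 d.-1) big_mkord -/(arc_weight z i.+1 d.-1).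
  by rewrite !big_cons big_nil /= addr0 -weight7 !addrA.
by rewrite arc_edge_sum_sizeSS // cd cd1 c1 /=; lra.
Qed.

Lemma sparse_arc_of_prefix (i : nat) : (1 < d)%N -> 7 <= arc_weight z i d.+1 ->
  z i * (7 - arc_weight z i d) <= 98 / 25 -> has_sparse_arc d z.
Proof.
move=> d_gt1 heavy cost.
have [/sparse_arc_of_heavy_nbhd //|light] := lerP 7 (arc_weight z i d).
have := (cyclic_weight_ge0 i, cyclic_weight_ge0 (i + d.+1), arc_weight_head i).
move: heavy; rewrite arc_weightSr => heavy [[z_ge0 next_ge0] head].
by apply: (@sparse_arc_of_ends i (z i) (7 - arc_weight z i d) 0 d_gt1); lra.
Qed.

Lemma sparse_arc_of_suffix (i : nat) : (1 < d)%N -> 7 <= arc_weight z i d.+1 ->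
  z (i + d)%N * (7 - arc_weight z i.+1 d) <= 98 / 25 -> has_sparse_arc d z.
Proof.
move=> d_gt1 heavy cost.
have [/sparse_arc_of_heavy_nbhd //|light] := lerP 7 (arc_weight z i.+1 d).
have := (cyclic_weight_ge0 (i + d), cyclic_weight_ge0 (i + d.+1), arc_weight_last i).
move: heavy; rewrite arc_weightS => heavy [[z_ge0 next_ge0] last].
by apply: (@sparse_arc_of_ends i (7 - arc_weight z i.+1 d) (z (i + d)%N) 0 d_gt1); lra.
Qed.

Lemma sparse_arc_of_extension (i : nat) : (1 < d)%N ->
  arc_weight z i d.+1 <= 7 -> 7 <= arc_weight z i d.+2 ->
  z i * z (i + d)%N + (z i + z i.+1) * (7 - arc_weight z i d.+1) <= 98 / 25 ->
  has_sparse_arc d z.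
Proof.
move=> d_gt1 light + cost; rewrite arc_weightSr => heavy.
have := (cyclic_weight_ge0 i, cyclic_weight_ge0 (i + d)).
have := (arc_weightS z i d, arc_weight_last i).
move=> [head last] [z_ge0 end_ge0].
by apply: (@sparse_arc_of_ends i (z i) (z (i + d)%N) (7 - arc_weight z i d.+1) d_gt1); lra.
Qed.

(* Neither of the two halves filling a heavy arc from one end is sparse. *)
Definition tight_arc (i : nat) : Prop :=
  98 / 25 < z i * (7 - arc_weight z i d) /\
  98 / 25 < z (i + d)%N * (7 - arc_weight z i.+1 d).

Lemma sparse_or_tight_arc (i : nat) : (1 < d)%N -> 7 <= arc_weight z i d.+1 ->
  has_sparse_arc d z \/ tight_arc i.
Proof.
move=> d_gt1 heavy.
have [/(sparse_arc_of_prefix d_gt1 heavy)|prefix] :=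
  lerP (z i * (7 - arc_weight z i d)) (98 / 25); first by left.
have [/(sparse_arc_of_suffix d_gt1 heavy)|suffix] :=
  lerP (z (i + d)%N * (7 - arc_weight z i.+1 d)) (98 / 25); first by left.
by right.
Qed.

Lemma tight_arc_ends (i : nat) : tight_arc i -> 49 / 25 < z i /\ 49 / 25 < z (i + d)%N.
Proof.
have [_ deg] := zP.
have end_gt j k : 98 / 25 < z j * (7 - arc_weight z k d) -> 49 / 25 < z j.
  have := deg k => deg_k cost.
  have : z j * (7 - arc_weight z k d) <= z j * 2.
    by rewrite ler_wpM2l ?cyclic_weight_ge0; lra.
  lra.
by case=> /end_gt ? /end_gt.
Qed.

(* If the arc weighs at least 7, filling it from the left costs at most
   z i * z (i + d). Otherwise at most 1/25 of the next vertex is needed. *)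
Lemma sparse_arc_of_end_product (i : nat) : (1 < d)%N ->
  z i * z (i + d)%N <= 3 -> 174 / 25 <= arc_weight z i d.+1 ->
  has_sparse_arc d z.
Proof.
move=> d_gt1 ends heavy; have z_ge1 := cyclic_weight_ge1.
have [full|light] := lerP 7 (arc_weight z i d.+1).
  apply: (sparse_arc_of_prefix d_gt1 full); apply: le_trans (_ : 3 <= _); last lra.
  apply: le_trans ends; rewrite ler_wpM2l ?cyclic_weight_ge0 //.
  by move: full; rewrite arc_weightSr; lra.
apply: (@sparse_arc_of_extension i d_gt1); first exact: ltW.
  by rewrite arc_weightSr; have := z_ge1 (i + d.+1)%N; lra.
have pair : z i + z i.+1 <= 7.
  have := arc_weight_ge0 i.+2 d.-1; move: light.
  by rewrite arc_weightS -[X in arc_weight z _ X](prednK (ltnW d_gt1)) arc_weightS; lra.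
have : (z i + z i.+1) * (7 - arc_weight z i d.+1) <= 7 * (1 / 25).
  by have := (z_ge1 i, z_ge1 i.+1) => -[? ?]; rewrite ler_pM; lra.
lra.
Qed.

End CyclicWeights.

Lemma sparse_arc1 (R : realFieldType) (z : nat -> R) :
  cyclic_weight 1 z -> has_sparse_arc 1 z.
Proof.
move=> zP; have [total _] := zP; have := total 0%N; rewrite !arc_weightS arc_weight0.
have [z0|z0] := lerP 7 (z 0%N) => total0.
  by apply: (sparse_arc_of_heavy_nbhd zP (i := 0)); rewrite arc_weightS arc_weight0 addr0.
by apply: (sparse_arc_of_heavy_nbhd zP (i := 1)); rewrite arc_weightS arc_weight0; lra.
Qed.

Lemma sparse_arc2 (R : realFieldType) (z : nat -> R) :
  cyclic_weight 2 z -> has_sparse_arc 2 z.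
Proof.
move=> zP; have [total _] := zP; have per := cyclic_weight_periodic zP.
pose cost i := z i * (7 - arc_weight z i 2).
(* The costs add up to 98 minus half the sum of the (z i + z i.+1) ^+ 2, and the
   z i + z i.+1 have mean 28 / 5. *)
have [i cost_i] : exists i : 'I_5, cost i <= 98 / 25.
  apply: exists_le_mean; rewrite card_ord //.
  have : 0 <= \sum_(i < 5) (z i + z i.+1 - 28 / 5) ^+ 2.
    by apply: sumr_ge0 => i _; exact: sqr_ge0.
  have := total 0%N; rewrite /cost !big_ord_recr !big_ord0 /= !arc_weightS !arc_weight0.
  rewrite (per 0%N); lra.
have [/(sparse_arc_of_heavy_nbhd zP) //|light] := lerP 7 (arc_weight z (i + 3) 2).
apply: (sparse_arc_of_prefix zP (i := i)) => //.
by have := arc_weight_complement zP i (m := 3) isT; rewrite /=; lra.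
Qed.

(* A transversal of the four antipodal pairs of residues modulo 8 without three
   consecutive elements is a rotation of {0, 1, 3, 6}. *)
Lemma antipodal_Z8_absurd (T : nat -> Prop) :
  (forall i, T (i + 8)%N = T i) -> (forall i, (i < 4)%N -> T i \/ T (i + 4)%N) ->
  (forall i, T i -> T i.+1 -> T i.+2 -> False) ->
  (forall i, T i -> T i.+1 -> T (i + 3)%N -> T (i + 6)%N -> False) -> False.
Proof.
move=> per anti run pattern.
move: (anti 0%N isT) (anti 1%N isT) (anti 2%N isT) (anti 3%N isT).
move: (run 0%N) (run 1%N) (run 2%N) (run 3%N) (run 4%N) (run 5%N) (run 6%N) (run 7%N).
move: (pattern 0%N) (pattern 1%N) (pattern 2%N) (pattern 3%N).
move: (pattern 4%N) (pattern 5%N) (pattern 6%N) (pattern 7%N).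
rewrite (per 0%N) (per 1%N) (per 2%N) (per 3%N) (per 4%N) (per 5%N); clear; tauto.
Qed.

Section F3.
Variables (R : realFieldType) (z : nat -> R).
Hypothesis zP : cyclic_weight 3 z.

Lemma tight_arc3_middle (i : nat) : tight_arc 3 z i -> z i.+1 + z i.+2 < 31 / 10.
Proof.
have := arc_weight_pred_le4 zP i.+1; rewrite /tight_arc !arc_weightS arc_weight0.
have := sqr_ge0 (2 * z i - (7 - z i.+1 - z i.+2)).
move=> square pair [cost _]; rewrite ltNge; apply/negP => heavy.
have : 0 <= (z i.+1 + z i.+2 - 31 / 10) * (109 / 10 - (z i.+1 + z i.+2)).
  by rewrite mulr_ge0; lra.
lra.
Qed.

Lemma tight_arc3_first (i : nat) :
  tight_arc 3 z i -> 29 / 10 <= z i.+1 + z i.+2 -> z i < 13 / 5.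
Proof.
case; rewrite !arc_weightS arc_weight0 => cost _ middle; rewrite ltNge; apply/negP => first.
have : 0 <= (z i - 13 / 5) * (z i - 3 / 2) by rewrite mulr_ge0; lra.
have : 0 <= z i * (z i.+1 + z i.+2 - 29 / 10) by rewrite mulr_ge0; lra.
lra.
Qed.

Lemma tight_arc3_or_complement (i : nat) :
  has_sparse_arc 3 z \/ (tight_arc 3 z i \/ tight_arc 3 z (i + 4)).
Proof.
have compl := arc_weight_complement zP i (m := 4) isT.
have [/(sparse_or_tight_arc zP isT)|light] := lerP 7 (arc_weight z i 4); first tauto.
have /(sparse_or_tight_arc zP isT) : 7 <= arc_weight z (i + 4) 4 by rewrite compl; lra.
tauto.
Qed.

Lemma tight_arc3_periodic (i : nat) : tight_arc 3 z (i + 8) = tight_arc 3 z i.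
Proof.
have per := cyclic_weight_periodic zP.
by rewrite /tight_arc !arc_weightS !arc_weight0 -!addSn -addnAC !per.
Qed.

Lemma tight_arc3_no_run3 (i : nat) :
  tight_arc 3 z i -> tight_arc 3 z i.+1 -> tight_arc 3 z i.+2 -> False.
Proof.
move=> /tight_arc3_middle ? /(tight_arc_ends zP)[? _] /(tight_arc_ends zP)[? _]; lra.
Qed.

Lemma tight_arc3_no_0136 (i : nat) :
  tight_arc 3 z i -> tight_arc 3 z i.+1 -> tight_arc 3 z (i + 3) ->
  tight_arc 3 z (i + 6) -> False.
Proof.
move=> tight0 tight1 tight3 tight6; have z_ge1 := cyclic_weight_ge1 zP.
have [[total _] per] := (zP, cyclic_weight_periodic zP i).
have := (tight_arc3_middle tight0, tight_arc3_middle tight1, tight_arc3_middle tight3,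
  tight_arc3_middle tight6, tight_arc3_first tight6, (tight_arc_ends zP tight0).1, total i).
rewrite !arc_weightS arc_weight0 !addnS !addn0 in per *.
have := (z_ge1 i.+2, z_ge1 i.+4.+3); rewrite per.
move=> [z2_ge1 z7_ge1] [[[[[[mid0 mid1] mid3] mid6] first6] end0] sum14].
have z6 : z i.+4.+2 < 13 / 5 by apply: first6; lra.
lra.
Qed.

Lemma sparse_arc3 : has_sparse_arc 3 z.
Proof.
have [//|tight0] := tight_arc3_or_complement 0.
have [//|tight1] := tight_arc3_or_complement 1.
have [//|tight2] := tight_arc3_or_complement 2.
have [//|tight3] := tight_arc3_or_complement 3.
exfalso; apply: (@antipodal_Z8_absurd (tight_arc 3 z)).
- exact: tight_arc3_periodic.
- by case=> [|[|[|[|]]]].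
- exact: tight_arc3_no_run3.
- exact: tight_arc3_no_0136.
Qed.

End F3.

Lemma sum_cyclic_products_ge (R : realFieldType) (d : nat) (z : nat -> R) (k : nat) :
  cyclic_weight d z -> 28 - (3 * d - 1)%:R <= \sum_(i < 3 * d - 1) z i * z (k + i)%N.
Proof.
move=> zP; have [total _] := zP.
have sum14 j : \sum_(i < 3 * d - 1) z (j + i)%N = 14 := total j.
have -> : 28 - (3 * d - 1)%:R = \sum_(i < 3 * d - 1) (z i + z (k + i)%N - 1).
  by rewrite sumrB big_split /= sumr_const card_ord (sum14 0%N) (sum14 k); lra.
apply: ler_sum => i _; rewrite -subr_ge0.
have -> : z i * z (k + i)%N - (z i + z (k + i)%N - 1) = (z i - 1) * (z (k + i)%N - 1).
  by ring.
by rewrite mulr_ge0 // subr_ge0 (cyclic_weight_ge1 zP).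
Qed.

Section F4.
Variables (R : realFieldType) (z : nat -> R).
Hypothesis zP : cyclic_weight 4 z.

Lemma sparse_arc4_heavy (i : nat) : 7 <= arc_weight z i 5 -> has_sparse_arc 4 z.
Proof.
case/(sparse_or_tight_arc zP isT) => // /(tight_arc_ends zP)[end0 end4].
have [_ deg] := zP; have z_ge1 := cyclic_weight_ge1 zP.
have triple := arc_weight_pred_le4 zP.
have per := cyclic_weight_periodic zP i; rewrite /= in triple per.
have z_le2 j : z j <= 2.
  have := (triple j, z_ge1 j.+1, z_ge1 j.+2).
  by rewrite !arc_weightS arc_weight0 => -[[]]; lra.
have [z7|z7] := lerP (z (i + 7)%N) (3 / 2).
  apply: (sparse_arc_of_end_product zP (i := i + 7)) => //.
    by rewrite -addnA per; have := z_le2 i; have := z_ge1 (i + 7)%N; nra.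
  by rewrite arc_weightSr -addnA per; have := deg (i + 7)%N; lra.
apply: (sparse_arc_of_end_product zP (i := i + 4)) => //.
  have z8 : z (i + 7).+1 <= 3 / 2.
    have := (triple (i + 7)%N, z_ge1 (i + 7).+2).
    by rewrite !arc_weightS arc_weight0 => -[]; lra.
  rewrite -addnA (addnS i 7); have := z_le2 (i + 4)%N; have := z_ge1 (i + 7).+1; nra.
by rewrite arc_weightS; have := deg (i + 4).+1; lra.
Qed.

Lemma sparse_arc4 : has_sparse_arc 4 z.
Proof.
have [total _] := zP; have per := cyclic_weight_periodic zP; rewrite /= in per.
have [/existsP[i /sparse_arc4_heavy //]|/existsPn light] :=
  boolP [exists i : 'I_11, 7 <= arc_weight z i 5].
pose cost i := z i * z (i + 4)%N + (z i + z i.+1) * (7 - arc_weight z i 5).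
pose corr k := \sum_(i < 11) z i * z (k + i)%N.
have corr_ge k : 17 <= corr k.
  by have : 28 - 11 <= corr k := sum_cyclic_products_ge k zP; lra.
have [i cost_i] : exists i : 'I_11, cost i <= 98 / 25.
  apply: exists_le_mean; rewrite card_ord //.
  have -> : \sum_(i < 11) cost i =
      196 - 2 * corr 0%N - 3 * corr 1%N - 2 * corr 2%N - 2 * corr 3%N.
    have := total 0%N.
    rewrite /corr /cost !big_ord_recr !big_ord0 !arc_weightS !arc_weight0 /= ?addnS ?addn0.
    rewrite ?(per 0%N) ?(per 1%N) ?(per 2%N) ?(per 3%N).
    lra.
  by have := (corr_ge 0%N, corr_ge 1%N, corr_ge 2%N, corr_ge 3%N) => -[[[]]]; lra.
have [/sparse_arc4_heavy //|light6] := lerP 7 (arc_weight z (i + 6) 5).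
apply: (sparse_arc_of_extension zP (i := i)) => //.
  by have := light i; rewrite -ltNge => /ltW.
by have := arc_weight_complement zP i (m := 6) isT; rewrite /=; lra.
Qed.

End F4.

Lemma sparse_arc5 (R : realFieldType) (z : nat -> R) :
  cyclic_weight 5 z -> has_sparse_arc 5 z.
Proof.
move=> zP; have z1 i : z i = 1.
  have := (arc_weight_pred_le4 zP i, cyclic_weight_ge1 zP i, cyclic_weight_ge1 zP i.+1,
    cyclic_weight_ge1 zP i.+2, cyclic_weight_ge1 zP i.+3) => /=.
  by rewrite !arc_weightS arc_weight0 => -[[[[]]]]; lra.
apply: (sparse_arc_of_extension zP (i := 0)) => //.
all: by rewrite !arc_weightS arc_weight0 !z1; lra.
Qed.

Lemma sparse_arc_le5 (R : realFieldType) (d : nat) (z : nat -> R) :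
  (d <= 5)%N -> cyclic_weight d z -> has_sparse_arc d z.
Proof.
case: d => [|[|[|[|[|[|//]]]]]] _.
- by move/cyclic_weight_d_gt0.
- exact: sparse_arc1.
- exact: sparse_arc2.
- exact: sparse_arc3.
- exact: sparse_arc4.
- exact: sparse_arc5.
Qed.

Theorem theorem3p1 (R : realType) (d : nat) (hd : (1 <= d <= 5)%N)
    (omega : 'I_(3 * d - 1) -> R)
    (homega : is_weight omega)
    (hdeg : min_degree_ge (@F_adj d) omega (5 / 14)) :
  exists s : 'I_(3 * d - 1) -> R, is_sparse_half (@F_adj d) omega s.
Proof.
have [d_gt0 d_le5] := andP hd; have npos : (0 < 3 * d - 1)%N by lia.
have zP := cyclic_weight_residue npos homega hdeg.
exact: sparse_half_of_arc (sparse_arc_le5 d_le5 zP).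
Qed.
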